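(* Let $1\le p\le n$, let $A$ be a real symmetric $n\times n$ matrix, let $s_1,\dots,s_q\ge1$ be integers with $s_1+\dots+s_q=p$, and let $\mu_1,\dots,\mu_p$ be real numbers with $$0<\mu_1=\dots=\mu_{s_1}<\mu_{s_1+1}=\dots=\mu_{s_1+s_2}<\dots<\mu_{s_1+\dots+s_{q-1}+1}=\dots=\mu_{s_1+\dots+s_q}.$$ Put $J_1=\{1,\dots,s_1\}$, ..., $J_q=\{s_1+\dots+s_{q-1}+1,\dots,p\}$. Then $U=[\mathbf u_1,\dots,\mathbf u_p]\in St^n_p$ is a critical point of the Brockett cost function $G_B:St^n_p\to\mathbb R$, $G_B(U)=\sum_{i=1}^p\mu_i\mathbf u_i^TA\mathbf u_i$, if and only if $\mathrm{Span}\{\mathbf u_k\mid k\in J_l\}$ is an invariant subspace of $A$ for all $l\in\{1,\dots,q\}$.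
   Context: $St_p^n=\{U\in\mathcal M_{n\times p}(\mathbb R)\mid U^TU=\mathbb I_p\}$ is the orthogonal Stiefel manifold; $\mathbf u_1,\dots,\mathbf u_p\in\mathbb R^n$ are the columns of $U$. The sets $J_1,\dots,J_q$ are the consecutive blocks of indexes on which $\mu$ is constant. *)

(* Defs.v *)
From HB Require Import structures.
From mathcomp Require Import all_boot all_order all_algebra.
From mathcomp Require Import all_classical all_reals all_analysis.
Set Implicit Arguments.
Unset Strict Implicit.
Unset Printing Implicit Defensive.
Import Order.TTheory GRing.Theory Num.Theory.
Import numFieldNormedType.Exports.
Local Open Scope classical_set_scope.
Local Open Scope ring_scope.

Definition stiefel (R : realType) (n p : nat) : set 'M[R]_(n, p) :=
  [set U | U^T *m U = 1%:M].

(* [x] is a critical point of the restriction of [f] to [S]: the differential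
   of [f] along [S] vanishes on every velocity at [x] of a curve lying in [S].
   Only the values of [f] on [S] matter. The type of [f] allows it to be given
   by a formula on the ambient space [V]; near [0] the curves stay in [S]. *)
Definition critical_point (R : realType) (V : normedModType R)
    (S : set V) (f : V -> R) (x : V) : Prop :=
  forall gamma : R -> V,
    gamma 0 = x ->
    (\forall t \near (0 : R), S (gamma t)) ->
    derivable gamma (0 : R) 1 ->
    is_derive (0 : R) 1 (f \o gamma) (0 : R).

Definition brockett (R : realType) (n p : nat) (A : 'M[R]_n) (mu : 'I_p -> R)
    (U : 'M[R]_(n, p)) : R :=
  \sum_(i < p) mu i * ((col i U)^T *m A *m col i U) 0 0.

(* Indices start at 0: the first block is {0, ..., s_0 - 1}, and so on. *)
Definition block (p q : nat) (s : 'I_q -> nat) (l : 'I_q) : {pred 'I_p} :=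
  [pred i : 'I_p | (\sum_(k < q | k < l) s k <= i
                    < \sum_(k < q | k <= l) s k)%N].

Definition invariant_subspace (R : realType) (n : nat) (A : 'M[R]_n)
    (W : {vspace 'cV[R]_n}) : Prop :=
  forall v : 'cV[R]_n, v \in W -> A *m v \in W.

(* Main.v *)
Require Import Defs.
From HB Require Import structures.
From mathcomp Require Import all_boot all_order all_algebra.
From mathcomp Require Import all_classical all_reals all_analysis.
From mathcomp Require Import ring lra.
Set Implicit Arguments.
Unset Strict Implicit.
Unset Printing Implicit Defensive.
Import Order.TTheory GRing.Theory Num.Theory.
Import numFieldNormedType.Exports.
Local Open Scope classical_set_scope.
Local Open Scope ring_scope.

(* With D = diag(mu) and S = U D U^T, the point U is critical exactly when S and
   A commute. One direction moves U along the ambient rotations exp(tX) with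
   X = E_ij - E_ji: the derivative of the cost is tr(X (SA - AS)), and SA - AS is
   skew. For the other, a velocity V has V^T U + U^T V = 0, and commutation makes
   the derivative tr((V^T U + U^T V) D B) with B = U^T A U. Finally, since the mu_k
   are nonzero and take distinct values on distinct blocks, the spans in question
   are the eigenspaces of S for its nonzero eigenvalues, and A commutes with S iff
   it preserves them. *)

(** * Differentiation of matrix-valued maps *)

Lemma is_derive_mxP (R : realFieldType) (V : normedModType R) (m n : nat)
    (M : V -> 'M[R]_(m, n)) (dM : 'M[R]_(m, n)) (t v : V) :
  is_derive t v M dM <->
  forall i j, is_derive t v (fun x => M x i j) (dM i j).
Proof.
split=> [[dvM <-] i j | dvM].
  by split; [exact: (derivable_mxP M t v).1 | rewrite derive_mx // mxE].
have dvM' : derivable M t v.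
  by apply/derivable_mxP => i j; case: (dvM i j).
split=> //; rewrite derive_mx //; apply/matrixP => i j.
by rewrite mxE; case: (dvM i j).
Qed.

Lemma is_derive_mulmx (R : realFieldType) (V : normedModType R) (m n p : nat)
    (M : V -> 'M[R]_(m, n)) (N : V -> 'M[R]_(n, p))
    (dM : 'M[R]_(m, n)) (dN : 'M[R]_(n, p)) (t v : V) :
  is_derive t v M dM -> is_derive t v N dN ->
  is_derive t v (fun x => M x *m N x) (dM *m N t + M t *m dN).
Proof.
move=> /is_derive_mxP dvM /is_derive_mxP dvN; apply/is_derive_mxP => i j.
have -> : (fun x => (M x *m N x) i j) =
    \sum_(k < n) ((fun x => M x i k) * (fun x => N x k j)).
  by apply/funext => x; rewrite mxE fct_sumE; apply: eq_bigr.
have dS := is_derive_sum (fun k => is_deriveM (dvM i k) (dvN k j)).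
apply: (is_derive_eq dS).
rewrite !mxE -big_split /=.
by apply: eq_bigr => k _; rewrite addrC; congr (_ + _); exact: mulrC.
Qed.

Lemma is_derive_trmx (R : realFieldType) (V : normedModType R) (m n : nat)
    (M : V -> 'M[R]_(m, n)) (dM : 'M[R]_(m, n)) (t v : V) :
  is_derive t v M dM -> is_derive t v (fun x => (M x)^T) dM^T.
Proof.
move=> /is_derive_mxP dvM; apply/is_derive_mxP => i j; rewrite mxE.
by under eq_fun do rewrite mxE.
Qed.

Lemma is_derive_mxtrace (R : realFieldType) (V : normedModType R) (n : nat)
    (M : V -> 'M[R]_n) (dM : 'M[R]_n) (t v : V) :
  is_derive t v M dM -> is_derive t v (fun x => \tr (M x)) (\tr dM).
Proof.
move=> /is_derive_mxP dvM.
have -> : (fun x => \tr (M x)) = \sum_(i < n) (fun x => M x i i).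
  by apply/funext => x; rewrite fct_sumE.
exact: is_derive_sum.
Qed.

(** * Derivative of the cost and velocities on the Stiefel manifold *)

Lemma brockettE (R : realType) (n p : nat) (A : 'M[R]_n) (mu : 'I_p -> R) U :
  brockett A mu U = \tr (U^T *m A *m U *m diag_mx (\row_i mu i)).
Proof.
apply: eq_bigr => i _; rewrite mul_mx_diag !mxE mulrC; congr (_ * _).
by apply: eq_bigr => k _; rewrite tr_col -row_mul !mxE.
Qed.

Lemma is_derive_brockett (R : realType) (n p : nat) (A : 'M[R]_n)
    (mu : 'I_p -> R) (gamma : R -> 'M[R]_(n, p)) V (t : R) :
  is_derive t 1 gamma V ->
  is_derive t 1 (brockett A mu \o gamma)
    (\tr ((V^T *m A *m gamma t + (gamma t)^T *m A *m V)
          *m diag_mx (\row_i mu i))).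
Proof.
move=> dg; have -> : brockett A mu \o gamma = fun x =>
    \tr ((gamma x)^T *m A *m gamma x *m diag_mx (\row_i mu i)).
  by apply/funext => x /=; rewrite brockettE.
apply: is_derive_mxtrace; set D := diag_mx _.
have dgA := is_derive_mulmx (is_derive_trmx dg) (is_derive_cst A t 1).
have dD := is_derive_mulmx (is_derive_mulmx dgA dg) (is_derive_cst D t 1).
by apply: (is_derive_eq dD); rewrite !mulmx0 !addr0.
Qed.

(** The product [(gamma t)^T *m gamma t] is constantly the identity near 0, so its derivative,
    computed by the product rule, vanishes. *)
Lemma stiefel_velocity (R : realType) (n p : nat)
    (gamma : R -> 'M[R]_(n, p)) V :
  (\forall t \near (0 : R), stiefel (gamma t)) -> is_derive (0 : R) 1 gamma V ->
  V^T *m gamma 0 + (gamma 0)^T *m V = 0.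
Proof.
move=> gS dg; have [_ <-] := is_derive_mulmx (is_derive_trmx dg) dg.
by rewrite (near_eq_derive (g := cst (1%:M : 'M[R]_p))) ?derive_cst.
Qed.

(** * Rotations, and commutation at critical points *)

(* The exponential of [t *: X] when [X *m X *m X = - X]. *)
Definition rotation (R : realType) (n : nat) (X : 'M[R]_n) (t : R) : 'M[R]_n :=
  1%:M + sin t *: X + (1 - cos t) *: (X *m X).

(** Transposition changes the sign of the [sin t] term only, so the odd powers of X cancel. As X^4 =
    - X^2, the coefficient of X^2 is 2(1 - cos t) - sin^2 t - (1 - cos t)^2 = 1 - sin^2 t - cos^2 t
    = 0. *)
Lemma rotation_orthogonal (R : realType) (n : nat) (X : 'M[R]_n) (t : R) :
  X^T = - X -> X *m X *m X = - X ->
  (rotation X t)^T *m rotation X t = 1%:M.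
Proof.
move=> XN X3.
have X4 : X *m X *m (X *m X) = - (X *m X) by rewrite mulmxA X3 mulNmx.
have -> : (rotation X t)^T = 1%:M - sin t *: X + (1 - cos t) *: (X *m X).
  rewrite /rotation !raddfD /= trmx1 ![(_ *: _)^T]linearZ /= trmx_mul XN scalerN.
  by rewrite mulNmx mulmxN opprK.
rewrite /rotation !mulmxDl !mulmxDr !mul1mx !mulmx1 !mulNmx -!scalemxAl -!scalemxAr.
rewrite X4 (mulmxA X X X) X3.
move: (X *m X) (cos2Dsin2 t) => Y cs.
apply/matrixP => i j; rewrite !mxE.
have -> : sin t * (sin t * Y i j) = (1 - cos t ^+ 2) * Y i j.
  rewrite mulrA -expr2; congr (_ * _); lra.
ring.
Qed.

Lemma is_derive_rotation (R : realType) (n : nat) (X : 'M[R]_n) :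
  is_derive (0 : R) 1 (rotation X) X.
Proof.
apply/is_derive_mxP => i j.
have -> : (fun t => rotation X t i j) = (cst (1%:M i j) : R -> R)
    + sin * cst (X i j) + (cst 1 - cos) * cst ((X *m X) i j).
  by apply/funext => t; rewrite /rotation [LHS]mxE [X in X + _]mxE
    [X in _ + X + _]mxE [X in _ + X]mxE.
apply: is_derive_eq; rewrite sin0 cos0 !(oppr0, scaler0, add0r, addr0).
exact: mulr1.
Qed.

Lemma mxtrace_delta_mul (R : comNzRingType) (n : nat) (C : 'M[R]_n) i j :
  \tr (delta_mx i j *m C) = C j i.
Proof.
rewrite -(mul_delta_mx (0 : 'I_1)) -mulmxA -rowE mxtrace_mulC -colE.
by rewrite trace_mx11 !mxE.
Qed.

Lemma critical_brockett_comm (R : realType) (n p : nat) (A : 'M[R]_n)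
    (hA : A^T = A) (mu : 'I_p -> R) (U : 'M[R]_(n, p)) (hU : stiefel U)
    (S := U *m diag_mx (\row_i mu i) *m U^T) :
  critical_point (@stiefel R n p) (brockett A mu) U -> S *m A = A *m S.
Proof.
move=> crit.
have ST : S^T = S by rewrite /S !trmx_mul trmxK tr_diag_mx mulmxA.
pose C := S *m A - A *m S.
have CT : C^T = - C by rewrite /C linearB /= trmx_mul hA ST trmx_mul hA ST opprB.
have trXC (X : 'M[R]_n) : X^T = - X -> X *m X *m X = - X -> \tr (X *m C) = 0.
  move=> XN X3.
  (* The test curve [rotation X t *m U] stays on the manifold and leaves [U] with velocity
     [X *m U]. *)
  have dg := is_derive_mulmx (is_derive_rotation X)
    (is_derive_cst (U : 'M[R]_(n, p)) (0 : R) 1).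
  have Q0 : rotation X 0 = 1%:M.
    by rewrite /rotation sin0 cos0 subrr !scale0r !addr0.
  have [|||_] := crit (fun t => rotation X t *m U).
  - by rewrite Q0 mul1mx.
  - near=> t; rewrite /stiefel /= trmx_mul mulmxA -(mulmxA U^T).
    by rewrite rotation_orthogonal // mulmx1.
  - by case: dg.
  rewrite (@derive_val _ _ _ _ _ _ _ (is_derive_brockett A mu dg)).
  rewrite mulmx0 addr0 Q0 mul1mx trmx_mul XN mulmxN !mulNmx.
  rewrite mulmxDl mulNmx linearD linearN /=.
  (* Cyclicity of the trace brings [X] to the front and reassembles [S] from its three factors. *)
  have -> : \tr (U^T *m X *m A *m U *m diag_mx (\row_i mu i)) =
      \tr (X *m A *m S).
    by rewrite -!mulmxA mxtrace_mulC /S !mulmxA.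
  have -> : \tr (U^T *m A *m (X *m U) *m diag_mx (\row_i mu i)) =
      \tr (X *m S *m A).
    by rewrite -!mulmxA mxtrace_mulC -mulmxA mxtrace_mulC /S !mulmxA.
  by move=> <-; rewrite /C mulmxBr linearB /= !mulmxA addrC.
apply/eqP; rewrite -subr_eq0; apply/eqP/matrixP => i j; rewrite -/C [RHS]mxE.
have CN k l : C l k = - C k l by rewrite -[in LHS](trmxK C) CT mxE [LHS]mxE.
have [<-|ij] := eqVneq i j; first by have := CN i i; lra.
have ji : j != i by rewrite eq_sym.
(* For i != j the square of E_ij - E_ji is - (E_ii + E_jj), minus the projection onto the plane of
   e_i and e_j. *)
have X3 : (delta_mx i j - delta_mx j i) *m (delta_mx i j - delta_mx j i)
    *m (delta_mx i j - delta_mx j i) = - (delta_mx i j - delta_mx j i) :> 'M[R]_n.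
  rewrite !(mulmxBl, mulmxBr, mul_delta_mx, mul_delta_mx_0, mul0mx) //.
  by rewrite !(sub0r, subr0, oppr0, opprK, addr0) opprB addrC.
(* Here tr(X C) = C_ji - C_ij = - 2 C_ij. *)
have := trXC _ _ X3; rewrite linearB /= !trmx_delta opprB => /(_ erefl).
by rewrite mulmxBl linearB /= !mxtrace_delta_mul [C j i]CN; lra.
Unshelve. all: end_near.
Qed.

(** * Spans of columns as eigenspaces *)

(** [S] scales column k by [mu k] and kills the orthogonal complement of the columns; [c != 0] keeps
    that complement out of the eigenspace. *)
Lemma span_col_eigen (R : realType) (n p : nat) (U : 'M[R]_(n, p))
    (hU : stiefel U) (mu : 'I_p -> R) (c : R) (B : {pred 'I_p}) :
  c != 0 -> (forall k, (k \in B) = (mu k == c)) ->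
  forall v : 'cV[R]_n, (v \in span [seq col k U | k in B]) =
    (U *m diag_mx (\row_i mu i) *m U^T *m v == c *: v).
Proof.
move=> c0 Bc v; set D := diag_mx _; set S := U *m D *m U^T.
have SU : S *m U = U *m D by rewrite /S -mulmxA hU mulmx1.
apply/idP/eqP => [vU | Sv].
  pose f := linfun (mulmx (S - c%:M) : 'cV[R]_n -> 'cV[R]_n).
  have /subvP/(_ v vU) : (span [seq col k U | k in B] <= lker f)%VS.
    apply/span_subvP => _ /fintype.imageP[k kB ->]; rewrite memv_ker lfunE /=.
    rewrite colE mulmxA mulmxBl SU mul_scalar_mx mulmxBl -scalemxAl -!colE.
    apply/eqP/matrixP => i j; rewrite mul_mx_diag !mxE.
    by move: kB; rewrite Bc => /eqP ->; rewrite mulrC subrr.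
  by rewrite memv_ker lfunE /= mulmxBl mul_scalar_mx subr_eq0 => /eqP.
have DUv : D *m (U^T *m v) = c *: (U^T *m v).
  have := congr1 (mulmx U^T) Sv; rewrite -scalemxAr => <-.
  by rewrite /S !mulmxA hU mul1mx.
(* Writing v as c^-1 S v expands it on the columns. By [DUv], (mu_k - c) (U^T v)_k = 0, so only the
   columns with mu_k = c contribute. *)
have -> : v = c^-1 *: \sum_k (mu k * (U^T *m v) k 0) *: col k U.
  apply: (scalerI c0); rewrite scalerA divff // scale1r -Sv /S -!mulmxA.
  apply/matrixP => i j; rewrite mxE summxE; apply: eq_bigr => k _.
  by rewrite ord1 mul_diag_mx !mxE mulrC.
apply/memvZ/memv_suml => k _.
have := congr1 (fun w : 'cV[R]_p => w k 0) DUv.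
rewrite mul_diag_mx [LHS]mxE [X in X * _]mxE [RHS]mxE => /eqP.
rewrite -subr_eq0 -mulrBl mulf_eq0 subr_eq0 => /orP[kc | /eqP ->].
  by apply/memvZ/memv_span/fintype.imageP; exists k; rewrite ?Bc.
by rewrite mulr0 scale0r mem0v.
Qed.

(** * Commutation implies criticality *)

(** Commutation is asked only on the columns of [U], where S U = U D: this is what invariance of the
    spans yields column by column. *)
Lemma brockett_comm_critical (R : realType) (n p : nat) (A : 'M[R]_n)
    (hA : A^T = A) (mu : 'I_p -> R) (U : 'M[R]_(n, p)) (hU : stiefel U)
    (D := diag_mx (\row_i mu i)) :
  U *m D *m U^T *m A *m U = A *m U *m D ->
  critical_point (@stiefel R n p) (brockett A mu) U.
Proof.
move=> comm gamma g0 gS dg; set V := 'D_1 gamma 0.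
have dV : is_derive (0 : R) 1 gamma V by split.
apply: (is_derive_eq (is_derive_brockett A mu dV)); rewrite g0 -/D.
have := stiefel_velocity gS dV; rewrite g0 => UV.
pose B := U^T *m A *m U.
have AUD : A *m U *m D = U *m (D *m B) by rewrite -comm /B !mulmxA.
(* Transpose of [AUD], [B] being symmetric because [A] is. *)
have DUA : D *m U^T *m A = B *m D *m U^T.
  have := congr1 trmx AUD.
  by rewrite /B !trmx_mul !trmxK hA tr_diag_mx !mulmxA.
have DB : D *m B = B *m D.
  by have := congr1 (mulmx U^T) AUD; rewrite [RHS]mulmxA hU mul1mx /B !mulmxA.
clearbody B; have -> : \tr ((V^T *m A *m U + U^T *m A *m V) *m D) =
    \tr ((V^T *m U + U^T *m V) *m (D *m B)).
  rewrite !mulmxDl !linearD /=; congr (_ + _).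
    by rewrite -!mulmxA (mulmxA A) AUD.
  by rewrite mxtrace_mulC [RHS]mxtrace_mulC !mulmxA DUA DB.
by rewrite UV mul0mx linear0.
Qed.

(** * Combinatorics of the blocks *)

Lemma mem_some_block (p q : nat) (s : 'I_q -> nat) (hsp : (\sum_(l < q) s l)%N = p)
  (i : 'I_p) : exists l, i \in block s l.
Proof.
(* Induction on the number m of leading blocks: an index in the first m+1 blocks but not in the
   first m lies in block m. *)
have key m : (m <= q)%N -> (i < \sum_(k < q | k < m) s k)%N ->
    exists l, i \in block s l.
  elim: m => [|m IH] mq; first by rewrite big_pred0.
  case: (ltnP i (\sum_(k < q | k < m) s k)%N) => [+ _|ge lt].
    exact: IH (ltnW mq).
  by exists (Ordinal mq); rewrite inE ge.
apply: (key q) => //; rewrite (eq_bigl predT) ?hsp // => k.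
exact: ltn_ord.
Qed.

Lemma block_inhabited (p q : nat) (s : 'I_q -> nat)
    (hs : forall l, (1 <= s l)%N) (hsp : (\sum_(l < q) s l)%N = p) (l : 'I_q) :
  exists i : 'I_p, i \in block s l.
Proof.
have lS : (\sum_(k < q | k <= l) s k = \sum_(k < q | k < l) s k + s l)%N.
  rewrite (bigD1 l) //= addnC; congr (_ + _)%N; apply: eq_bigl => k.
  by rewrite ltn_neqAle andbC.
(* The witness is the first index of the block, which is below [p] because [s l] is at least 1. *)
have lt : (\sum_(k < q | k < l) s k < p)%N.
  rewrite -hsp [X in (_ < X)%N](bigD1 l) //=; apply: (@leq_add 1) => //.
  rewrite big_mkcond [X in (_ <= X)%N]big_mkcond /=; apply: leq_sum => k _.
  by rewrite -(inj_eq val_inj) /=; case: ltngtP.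
exists (Ordinal lt); rewrite inE /= leqnn lS -[X in (X < _)%N]addn0 ltn_add2l.
exact: hs.
Qed.

(** [mu_incr] compares consecutive blocks only; induction on l' chains it through an element of each
    intermediate block, none of which is empty. *)
Lemma block_increasing (R : numDomainType) (p q : nat) (s : 'I_q -> nat)
    (hs : forall l, (1 <= s l)%N) (hsp : (\sum_(l < q) s l)%N = p)
    (mu : 'I_p -> R)
    (mu_incr : forall (l l' : 'I_q) (i j : 'I_p), l' = l.+1 :> nat ->
       i \in block s l -> j \in block s l' -> mu i < mu j)
    (l l' : 'I_q) (i j : 'I_p) :
  (l < l')%N -> i \in block s l -> j \in block s l' -> mu i < mu j.
Proof.
move=> + il; case: l' => m mq /=; elim: m mq j => // m IH mq j.
rewrite ltnS leq_eqVlt => /predU1P[lm | lm] jm.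
  by apply: mu_incr il jm; rewrite /= lm.
have [k km] := block_inhabited hs hsp (Ordinal (ltnW mq)).
by apply: (lt_trans (IH _ k lm km)); apply: mu_incr km jm.
Qed.

Theorem mainTheorem11 (R : realType) (n p q : nat)
    (hp : (1 <= p <= n)%N)
    (A : 'M[R]_n) (hA : A^T = A)
    (s : 'I_q -> nat) (hs : forall l, (1 <= s l)%N)
    (hsp : (\sum_(l < q) s l)%N = p)
    (mu : 'I_p -> R)
    (mu_pos : forall i, 0 < mu i)
    (mu_const : forall (l : 'I_q) (i j : 'I_p),
       i \in block s l -> j \in block s l -> mu i = mu j)
    (mu_incr : forall (l l' : 'I_q) (i j : 'I_p), l' = l.+1 :> nat ->
       i \in block s l -> j \in block s l' -> mu i < mu j)
    (U : 'M[R]_(n, p)) (hU : stiefel U) :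
  critical_point (@stiefel R n p) (brockett A mu) U <->
  forall l : 'I_q,
    invariant_subspace A (span [seq col k U | k in block s l]).
Proof.
(* Each block is a full level set of [mu]. *)
have inB l i0 : i0 \in block s l ->
    forall k, (k \in block s l) = (mu k == mu i0).
  move=> i0l k; apply/idP/eqP => [kl | muk]; first exact: mu_const kl i0l.
  have [l' kl'] := mem_some_block hsp k.
  have st := block_increasing hs hsp mu_incr.
  case: (ltngtP l l') => [ll'|l'l|/val_inj -> //].
    by have := st _ _ _ _ ll' i0l kl'; rewrite muk ltxx.
  by have := st _ _ _ _ l'l kl' i0l; rewrite muk ltxx.
have spanE l i0 (i0l : i0 \in block s l) :=
  span_col_eigen hU (lt0r_neq0 (mu_pos i0)) (inB l i0 i0l).
split=> [crit l v | inv].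
  have [i0 i0l] := block_inhabited hs hsp l.
  rewrite !(spanE l i0 i0l) mulmxA => /eqP Sv.
  by rewrite (critical_brockett_comm hA hU crit) -mulmxA Sv scalemxAr.
(* Column k of the identity says S A u_k = mu_k A u_k, that is, A u_k stays in the eigenspace
   spanned by the block of k. *)
apply: brockett_comm_critical => //; apply/matrixP => i k.
have [l kl] := mem_some_block hsp k.
have /inv : col k U \in span [seq col k U | k in block s l].
  by apply/memv_span/fintype.imageP; exists k.
rewrite (spanE l k kl) => /eqP/matrixP/(_ i 0).
rewrite mulmxA colE mulmxA -colE mxE => ->.
by rewrite mul_mx_diag mulmxA -colE !mxE mulrC.
Qed.
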